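(* Let $A\subseteq\omega$ be a c.e. infinite set and let $D$ be an effectively given domain with basis $B$ and numbering $\beta$ of the base elements. Then there is a computable onto map $\Gamma:\widehat{\mathcal S}^{(1)}_A\to D$ such that for all $f\in\widehat{\mathcal S}^{(1)}_A$: (1) If $f\in\mathrm{Anf}^{(1)}_A$ then $\Gamma(f)\in B$. (2) If $\beta[\mathrm{range}(f)]$ is directed then $\Gamma(f)\sqsubseteq\bigsqcup\beta[\mathrm{range}(f)]$. (3) If $f\in\mathcal R^{(1)}$ and $\beta[\mathrm{range}(f)]$ is directed then $\Gamma(f)=\bigsqcup\beta[\mathrm{range}(f)]$.
   Context: $\omega$ is the set of natural numbers; $\mathcal F^{(1)}$ is the set of all functions $\omega\to\omega$, $\mathcal R^{(1)}$ the set of total computable ones. $\langle\cdot,\cdot\rangle:\omega^2\to\omega$ is a computable bijection with $\langle x,y\rangle\ge x,y$. $\mathrm{Anf}^{(1)}_A$ is the set of partial functions from $\omega$ to $\omega$ whose domain is either empty or equal to $\{0,\dots,a-1\}$ for some $a\in A$, and $\widehat{\mathcal S}^{(1)}_A=\mathcal F^{(1)}\cup\mathrm{Anf}^{(1)}_A$, ordered by $f\sqsubseteq g$ iff the graph of $f$ is contained in the graph of $g$. A numbering of a set $X$ is a surjection $\omega\to X$. Domain theory: in a poset $(D,\sqsubseteq)$, a directed set is a non-empty subset in which every two elements have an upper bound in the subset. $x\ll y$ means: for every directed $L\subseteq D$ with existing least upper bound, $y\sqsubseteq\bigsqcup L$ implies $x\sqsubseteq u$ for some $u\in L$. $B\subseteq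 D$ is a basis if for each $x\in D$ the set $B_x=\{u\in B:u\ll x\}$ contains a directed subset with least upper bound $x$. A domain is a poset with least element $\bot$ in which all directed sets have least upper bounds and which has a basis. A domain $D$ with countable basis $B$ and numbering $\beta:\omega\to B$ is effectively given if $\{\langle i,j\rangle:\beta_i\ll\beta_j\}$ is c.e. A map $G:D\to D'$ between effectively given domains (numbered bases $\beta,\beta'$) is computable if it is Scott-continuous (monotone and preserving existing least upper bounds of directed sets) and $\{\langle i,j\rangle:\beta'_j\ll G(\beta_i)\}$ is c.e. $\widehat{\mathcal S}^{(1)}_A$ is regarded as an effectively given domain with basis $\mathrm{Anf}^{(1)}_A$ and the following numbering $\alpha^{(1)}$: let $f_A\in\mathcal R^{(1)}$ have range $A$ and fix an effective bijective coding of finite sequences of natural numbers by natural numbers, with length $\mathrm{lth}(a)$ and entries $(a)_j$, $1\le j\le\mathrm{lth}(a)$. Put $\widehat\alpha_{\langle a,b\rangle}(x)=(a)_{x+1}$ if $x<\min\{\mathrm{lth}(a),f_A(b)\}$; $=0$ if $\mathrm{lth}(a)\le x<f_A(b)$; undefined otherwise. $\alpha^{(1)}_0$ is the nowhere defined function and $\alpha^{(1)}_{i+1}=\widehat\alpha_j$ for the least $j$ with $\widehat\alpha_j\notin\{\alpha^{(1)}_0,\dots,\alpha^{(1)}_i\}$. *)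

(* Defs.v *)
From HB Require Import structures.
From mathcomp Require Import all_boot all_order.
From mathcomp Require Import boolp classical_sets functions cardinality.

Set Implicit Arguments.
Unset Strict Implicit.
Unset Printing Implicit Defensive.

Import Order.TTheory.

Local Open Scope classical_set_scope.
Local Open Scope order_scope.

Inductive recprog : nat -> Type :=
| RZero n : recprog n
| RSucc : recprog 1
| RProj n (i : 'I_n) : recprog n
| RComp m n (f : recprog m) (g : 'I_m -> recprog n) : recprog n
| RPrim n (f : recprog n) (g : recprog n.+2) : recprog n.+1
| RMin n (f : recprog n.+1) : recprog n.

(** Codes for the partial recursive functions: [reval c v y] means that the
    partial function denoted by [c] is defined at [v], with value [y].  In
    [RPrim f g] the recursion variable is the first argument, and [s k] is the
    value of the function at recursion argument [k]. *)
Fixpoint reval n (c : recprog n) : n.-tuple nat -> nat -> Prop :=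
  match c in recprog n return n.-tuple nat -> nat -> Prop with
  | RZero n => fun _ y => y = 0%N
  | RSucc => fun v y => y = (thead v).+1
  | RProj n i => fun v y => y = tnth v i
  | RComp m n f g => fun v y => exists w : m.-tuple nat,
      (forall i, reval (g i) v (tnth w i)) /\ reval f w y
  | RPrim n f g => fun v y => exists s : nat -> nat,
      [/\ reval f [tuple of behead v] (s 0%N),
          forall k, (k < thead v)%N ->
            reval g [tuple of k :: s k :: [tuple of behead v]] (s k.+1)
        & y = s (thead v)]
  | RMin n f => fun v y =>
      reval f [tuple of y :: v] 0%N /\
      forall k, (k < y)%N -> exists z, reval f [tuple of k :: v] z.+1
  end.

Definition computable n (F : n.-tuple nat -> nat) : Prop :=
  exists c : recprog n, forall v, reval c v (F v).

Definition computable1 (f : nat -> nat) : Prop :=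
  computable (fun v : 1.-tuple nat => f (thead v)).

Definition computable2 (f : nat -> nat -> nat) : Prop :=
  computable (fun v : 2.-tuple nat =>
    f (tnth v ord0) (tnth v (lift ord0 ord0))).

Definition ce (S : set nat) : Prop :=
  S = set0 \/ exists2 h : nat -> nat, computable1 h & range h = S.

Record pairing := Pairing {
  pair_code :> nat -> nat -> nat;
  pair_decode : nat -> nat * nat;
  pair_codeK : forall x y, pair_decode (pair_code x y) = (x, y);
  pair_decodeK : forall n, pair_code (pair_decode n).1 (pair_decode n).2 = n;
  pair_ge : forall x y, (x <= pair_code x y)%N /\ (y <= pair_code x y)%N;
  pair_computable : computable2 pair_code }.

(** The entries of the sequence coded by [a] are [(a)_1, ..., (a)_(lth a)], so
    [(a)_(x+1)] is the item of index [x] of [seq_decode a].  Since [lth] is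
    computable, it is immaterial that [nth] extends [(a)_j] by 0. *)
Record seq_coding := SeqCoding {
  seq_decode : nat -> seq nat;
  seq_decode_bij : bijective seq_decode;
  lth_computable : computable1 (fun a => size (seq_decode a));
  entry_computable : computable2 (fun a x => nth 0%N (seq_decode a) x) }.

Definition lth (c : seq_coding) (a : nat) : nat := size (seq_decode c a).
Definition entry (c : seq_coding) (a j : nat) : nat :=
  nth 0%N (seq_decode c a) j.-1.

Section Domains.
Context {d : Order.disp_t} {D : porderType d}.

Definition directed (L : set D) : Prop :=
  L !=set0 /\
  forall x y, L x -> L y -> exists2 z, L z & x <= z /\ y <= z.

Definition way_below (x y : D) : Prop :=
  forall (L : set D) (s : D), directed L -> supremums L s -> y <= s ->
  exists2 u, L u & x <= u.

Definition is_basis (B : set D) : Prop :=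
  forall x, exists L : set D,
    [/\ L `<=` [set u | B u /\ way_below u x], directed L & supremums L x].

Definition effectively_given (p : pairing) (B : set D) (beta : nat -> D) :=
  [/\ exists bot : D, forall x, bot <= x,
      forall L : set D, directed L -> exists s, supremums L s,
      is_basis B,
      range beta = B
    & ce [set n | exists i j, n = p i j /\ way_below (beta i) (beta j)]].

End Domains.

Definition scott_continuous d d' (D : porderType d) (D' : porderType d')
    (G : D -> D') : Prop :=
  {homo G : x y / x <= y} /\
  forall (L : set D) (s : D), directed L -> supremums L s ->
    supremums (G @` L) (G s).

Definition computable_map (p : pairing) d d' (D : porderType d)
    (D' : porderType d') (beta : nat -> D) (beta' : nat -> D') (G : D -> D') :=
  scott_continuous G /\
  ce [set n | exists i j, n = p i j /\ way_below (beta' j) (G (beta i))].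

Definition pfun := nat -> option nat.

HB.instance Definition _ := Choice.on pfun.

Definition pfun_le (f g : pfun) : bool :=
  `[< forall x y, f x = Some y -> g x = Some y >].

Lemma pfun_le_refl : reflexive pfun_le.
Proof. by move=> f; apply/asboolP. Qed.

Lemma pfun_le_anti : antisymmetric pfun_le.
Proof.
move=> f g /andP[/asboolP fg /asboolP gf]; apply/funext => x.
case fx: (f x) => [y|]; first by rewrite (fg _ _ fx).
by case gx: (g x) => [y|//]; rewrite (gf _ _ gx) in fx.
Qed.

Lemma pfun_le_trans : transitive pfun_le.
Proof.
move=> g f h /asboolP fg /asboolP gh; apply/asboolP => x y fx.
exact/gh/fg.
Qed.

Fact pfun_display : Order.disp_t. Proof. exact: Order.Disp tt tt. Qed.

HB.instance Definition _ := Order.Le_isPOrder.Build pfun_display pfun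
  pfun_le_refl pfun_le_anti pfun_le_trans.

Definition total_funs : set pfun := [set f | forall x, f x].

Definition anf (A : set nat) : set pfun :=
  [set f | (forall x, f x = None) \/
           exists2 a, A a & forall x, f x = (x < a)%N :> bool].

Record Shat (A : set nat) := MkShat {
  shat_fun :> pfun;
  shat_mem : shat_fun \in (total_funs `|` anf A)%classic }.

HB.instance Definition _ A := [isSub for @shat_fun A].
HB.instance Definition _ A := [Choice of Shat A by <:].
HB.instance Definition _ A := 
  [SubChoice_isSubPOrder of Shat A by <: with pfun_display].

Definition prange (f : pfun) : set nat := [set y | exists x, f x = Some y].

Definition total_computable (f : pfun) : Prop :=
  exists2 g : nat -> nat, computable1 g & forall x, f x = Some (g x).

Definition nowhere_pfun : pfun := fun=> None.

Lemma nowhere_mem (A : set nat) : nowhere_pfun \in (total_funs `|` anf A)%classic.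
Proof. by rewrite inE; right; left. Qed.

Definition nowhere A : Shat A := MkShat (nowhere_mem A).

Section Alpha.
Variables (p : pairing) (c : seq_coding).
Variables (A : set nat) (fA : nat -> nat) (fA_range : range fA = A).

Definition alpha_hat_pfun (a b : nat) : pfun := fun x =>
  if (x < minn (lth c a) (fA b))%N then Some (entry c a x.+1)
  else if (x < fA b)%N then Some 0%N
  else None.

Lemma alpha_hat_mem a b : alpha_hat_pfun a b \in (total_funs `|` anf A)%classic.
Proof.
rewrite inE; right; right; exists (fA b); first by rewrite -fA_range; exists b.
move=> x; rewrite /alpha_hat_pfun leq_min.
by case: (x < fA b)%N; rewrite ?andbF //; case: ifP.
Qed.

Definition alpha_hat (n : nat) : Shat A :=
  let: (a, b) := pair_decode p n in
  MkShat (alpha_hat_mem a b).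

(** For infinite [A] the [right] branch is never taken. *)
Definition next_alpha (s : seq (Shat A)) : Shat A :=
  match pselect (exists j, alpha_hat j \notin s) with
  | left ex => alpha_hat (ex_minn ex)
  | right _ => nowhere A
  end.

Fixpoint alpha_upto (i : nat) : seq (Shat A) :=
  if i is i'.+1 then
    let s := alpha_upto i' in rcons s (next_alpha s)
  else [:: nowhere A].

Definition alpha (i : nat) : Shat A := last (nowhere A) (alpha_upto i).

End Alpha.

(* Main.v *)
(** Let [h] enumerate the pairs <i, j> with [beta i] way below [beta j].  Reading
    [f 0, f 1, ...], build an increasing chain [beta k_0 <= beta k_1 <= ...]
    whose members lie way below some value [beta (f m)] read so far; then
    [Gamma f] is the supremum of the chain, which is finite for finite [f].
    At stage [n] only [f 0, ..., f n] is consulted, whence monotonicity and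
    continuity, and the number [n] is itself used as the guess of a next member
    together with witnesses that it is admissible.  To exhaust the supremum of
    [beta (f m)], the [t]-th extension of the chain must lie above the [t]-th
    pair (e, m) with [beta e] way below [beta (f m)].  When these values are
    directed, interpolation provides a correct guess, and every guess recurs at
    arbitrarily late stages.  This works for every total [f], computable or not,
    which makes [Gamma] onto. *)

Require Import Defs.
From mathcomp Require Import all_boot all_order.
From mathcomp Require Import boolp classical_sets functions cardinality.

Import Order.TTheory.

Local Open Scope classical_set_scope.
Local Open Scope order_scope.

(** * Closure properties of the computable functions *)

(** The entries of the argument of [F] serve as variables, numbered from 0.  Where
    a lemma below binds further variables they are put in front, so that the
    outer variables become the entries of [drop 1 s] or [drop 2 s]. *)
Definition rec_on (n : nat) (F : seq nat -> nat) : Prop :=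
  computable (fun v : n.-tuple nat => F v).

Definition prec (x : nat) (g : nat -> nat -> nat) (n : nat) : nat :=
  nat_rect (fun=> nat) x g n.

Lemma rec_on_ext {n F} G :
  rec_on n F -> (forall v : n.-tuple nat, F v = G (val v)) -> rec_on n G.
Proof. by move=> [e eF] FG; exists e => v; rewrite -FG. Qed.

Lemma rec_on_const n a : rec_on n (fun=> a).
Proof.
elim: a => [|a [e eP]]; first by exists (RZero n).
exists (RComp RSucc (fun=> e)) => v; exists [tuple a].
by split=> [i|//]; rewrite ord1.
Qed.

Lemma rec_on_var n i : rec_on n (fun s => nth 0%N s i).
Proof.
have [lt_in|le_ni] := ltnP i n.
  by exists (RProj (Ordinal lt_in)) => v /=; rewrite (tnth_nth 0%N).
by exists (RZero n) => v /=; rewrite nth_default // size_tuple.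
Qed.

Lemma rec_on_drop n j i : rec_on n (fun s => nth 0%N (drop j s) i).
Proof.
by apply: (rec_on_ext _ (rec_on_var n (j + i))) => v; rewrite nth_drop.
Qed.

Lemma rec_on_drop_drop n j k i :
  rec_on n (fun s => nth 0%N (drop j (drop k s)) i).
Proof.
by apply: (rec_on_ext _ (rec_on_drop n (j + k) i)) => v; rewrite drop_drop.
Qed.

Lemma rec_on_comp {m n F} (gs : m.-tuple (seq nat -> nat)) :
  rec_on m F -> (forall i, rec_on n (tnth gs i)) ->
  rec_on n (fun s => F [seq g s | g <- gs]).
Proof.
move=> [e eF] /choice[es esP]; exists (RComp e es) => v.
by exists (map_tuple (fun g => g (val v)) gs); split=> [i|//]; rewrite tnth_map.
Qed.

Lemma rec_on_comp1 {n} f {F} : rec_on 1 (fun s => f (nth 0%N s 0)) ->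
  rec_on n F -> rec_on n (fun s => f (F s)).
Proof.
move=> fP FP; apply: (rec_on_comp [tuple F] fP) => i.
by rewrite ord1.
Qed.

Lemma rec_on_comp2 {n} f {F G} :
  rec_on 2 (fun s => f (nth 0%N s 0) (nth 0%N s 1)) ->
  rec_on n F -> rec_on n G -> rec_on n (fun s => f (F s) (G s)).
Proof.
move=> fP FP GP; apply: (rec_on_comp [tuple F; G] fP).
by case=> [[|[|i]]] //= lt_i; rewrite (tnth_nth F).
Qed.

Lemma rec_on_comp3 {n} f {F G H} :
  rec_on 3 (fun s => f (nth 0%N s 0) (nth 0%N s 1) (nth 0%N s 2)) ->
  rec_on n F -> rec_on n G -> rec_on n H ->
  rec_on n (fun s => f (F s) (G s) (H s)).
Proof.
move=> fP FP GP HP; apply: (rec_on_comp [tuple F; G; H] fP).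
by case=> [[|[|[|i]]]] //= lt_i; rewrite (tnth_nth F).
Qed.

Lemma rec_on_cons {n F H} : rec_on n.+1 F -> rec_on n H ->
  rec_on n (fun s => F (H s :: s)).
Proof.
move=> FP HP.
pose gs := [tuple of H :: [tuple (fun s => nth 0%N s (i : 'I_n)) | i < n]].
apply: (rec_on_ext _ (rec_on_comp gs FP _)) => [i|v].
  have [->|[j ->]] : i = ord0 \/ exists j, i = lift ord0 j.
    by case: (unliftP ord0 i) => [j ->|->]; [right; exists j|left].
    by rewrite tnth0.
  by rewrite tnthS tnth_mktuple; exact: rec_on_var.
congr (F (_ :: _)); apply: (@eq_from_nth _ 0%N) => [|i].
  by rewrite size_map size_tuple size_tuple.
rewrite size_map size_tuple => lt_in.
rewrite (nth_map H) ?size_tuple //.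
by rewrite -(tnth_nth H (mktuple _) (Ordinal lt_in)) tnth_mktuple.
Qed.

Lemma rec_on_prec n F G H :
  rec_on n F -> rec_on n.+2 (fun s => G (nth 0%N s 0) (nth 0%N s 1) (drop 2 s)) ->
  rec_on n H ->
  rec_on n (fun s => prec (F s) (fun k r => G k r s) (H s)).
Proof.
move=> [eF FP] [eG GP] HP.
(* The recursion argument is first made a new front variable, the shape that [RPrim] demands; [H] is
   substituted for it afterwards. *)
have recP : rec_on n.+1 (fun s => prec (F (behead s))
    (fun k r => G k r (behead s)) (nth 0%N s 0)).
  exists (RPrim eF eG) => v.
  exists (prec (F (behead v)) (fun k r => G k r (behead v))).
  have -> : thead v = nth 0%N v 0 by rewrite /thead (tnth_nth 0%N).
  split=> [|k _|//]; first exact: (FP [tuple of behead v]).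
  have := GP [tuple of k :: prec (F (behead v))
    (fun k r => G k r (behead v)) k :: [tuple of behead v]].
  by rewrite /= drop0.
exact: (rec_on_cons recP HP).
Qed.

(** A truth value is 0 or 1, so the conditional is a recursion of that length with start value [G]
    and constant step [F]. *)
Lemma rec_on_if n (b : seq nat -> bool) F G :
  rec_on n (fun s => b s : nat) -> rec_on n F -> rec_on n G ->
  rec_on n (fun s => if b s then F s else G s).
Proof.
move=> bP FP GP.
have FG2 : rec_on 3 (fun s => prec (nth 0%N s 2) (fun _ _ => nth 0%N s 1)
    (nth 0%N s 0)).
  apply: (rec_on_prec 3 (fun s => nth 0%N s 2) (fun _ _ s => nth 0%N s 1)).
  - exact: rec_on_var.
  - exact: rec_on_drop.
  - exact: rec_on_var.
apply: (rec_on_ext _ (rec_on_comp3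
  (fun x y z => prec z (fun _ _ => y) x) FG2 bP FP GP)) => v.
by case: (b v).
Qed.

Lemma rec_on_and n (a b : seq nat -> bool) :
  rec_on n (fun s => a s : nat) -> rec_on n (fun s => b s : nat) ->
  rec_on n (fun s => a s && b s : nat).
Proof.
move=> aP bP; apply: (rec_on_ext _ (rec_on_if n a _ _ aP bP
  (rec_on_const n 0%N))) => v.
by case: (a v).
Qed.

Lemma rec_on_neg n (a : seq nat -> bool) :
  rec_on n (fun s => a s : nat) -> rec_on n (fun s => ~~ a s : nat).
Proof.
move=> aP; apply: (rec_on_ext _ (rec_on_if n a _ _ aP
  (rec_on_const n 0%N) (rec_on_const n 1%N))) => v.
by case: (a v).
Qed.

Lemma rec_on_imply n (a b : seq nat -> bool) :
  rec_on n (fun s => a s : nat) -> rec_on n (fun s => b s : nat) ->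
  rec_on n (fun s => a s ==> b s : nat).
Proof.
move=> aP bP; apply: (rec_on_ext _ (rec_on_if n a _ _ aP bP
  (rec_on_const n 1%N))) => v.
by case: (a v).
Qed.

Lemma rec_on_S n F : rec_on n F -> rec_on n (fun s => (F s).+1).
Proof.
move=> FP; apply: (rec_on_comp1 S) FP.
by exists RSucc => v /=; rewrite /thead (tnth_nth 0%N).
Qed.

Lemma rec_on_pred n F : rec_on n F -> rec_on n (fun s => (F s).-1).
Proof.
move=> FP; apply: (rec_on_ext _ (rec_on_prec n (fun=> 0%N) (fun k _ _ => k) F
  (rec_on_const n _) (rec_on_var _ _) FP)) => v.
by case: (F v).
Qed.

Lemma rec_on_sub n F G : rec_on n F -> rec_on n G ->
  rec_on n (fun s => F s - G s)%N.
Proof.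
move=> FP GP; apply: (rec_on_ext _ (rec_on_prec n F (fun _ r _ => r.-1) G
  FP (rec_on_pred _ _ (rec_on_var _ 1)) GP)) => v.
by elim: (G v) => [|m IH] /=; rewrite ?subn0 // subnS -IH.
Qed.

Lemma rec_on_eq n F G : rec_on n F -> rec_on n G ->
  rec_on n (fun s => F s == G s : nat).
Proof.
have is0 E : rec_on n E -> rec_on n (fun s => E s == 0%N : nat).
  move=> EP; apply: (rec_on_ext _ (rec_on_sub n (fun=> 1%N) E
    (rec_on_const n _) EP)) => v.
  by case: (E v).
move=> FP GP.
apply: (rec_on_ext _ (rec_on_and n _ _ (is0 _ (rec_on_sub n _ _ FP GP))
  (is0 _ (rec_on_sub n _ _ GP FP)))) => v.
by rewrite !subn_eq0 -eqn_leq.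
Qed.

Lemma rec_on_all n (b : nat -> seq nat -> bool) H :
  rec_on n.+2 (fun s => b (nth 0%N s 0) (drop 2 s) : nat) -> rec_on n H ->
  rec_on n (fun s => all (b^~ s) (iota 0 (H s)) : nat).
Proof.
move=> bP HP; apply: (rec_on_ext _ (rec_on_prec n (fun=> 1%N)
  (fun k r s => b k s && (r == 1%N) : nat) H (rec_on_const n _) _ HP)) => [|v].
  apply: rec_on_and bP _.
  by apply: rec_on_eq; [exact: rec_on_var|exact: rec_on_const].
elim: (H v) => [//|m IH]; rewrite -[in RHS]addn1 iotaD all_cat /=.
by rewrite IH andbT andbC; case: all.
Qed.

(** [RMin] looks for a zero, hence the negated test in the proof. The condition on [F] says both
    that the search stops and where. *)
Lemma rec_on_min n (b : nat -> seq nat -> bool) F :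
  rec_on n.+1 (fun s => b (nth 0%N s 0) (drop 1 s) : nat) ->
  (forall v : n.-tuple nat,
     b (F (val v)) v /\ forall k, (k < F (val v))%N -> ~~ b k v) ->
  rec_on n F.
Proof.
move=> /rec_on_neg[e bP] Fmin; exists (RMin e) => v /=.
have [bF bk] := Fmin v; split=> [|k /bk bkv].
  by have := bP [tuple of F v :: v]; rewrite /= drop0 bF.
by exists 0%N; have := bP [tuple of k :: v]; rewrite /= drop0 bkv.
Qed.

Lemma rec_on_computable1 n f F : computable1 f -> rec_on n F ->
  rec_on n (fun s => f (F s)).
Proof.
move=> [e fP]; apply: rec_on_comp1; exists e => v.
by have := fP v; rewrite /thead (tnth_nth 0%N).
Qed.

Lemma rec_on_computable2 n f F G : computable2 f -> rec_on n F -> rec_on n G ->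
  rec_on n (fun s => f (F s) (G s)).
Proof.
move=> [e fP]; apply: rec_on_comp2; exists e => v.
by have := fP v; rewrite !(tnth_nth 0%N).
Qed.

Lemma computable1_rec_on f : rec_on 1 (fun s => f (nth 0%N s 0)) ->
  computable1 f.
Proof. by move=> [e fP]; exists e => v; rewrite /thead (tnth_nth 0%N). Qed.

(** * Computability of the projections of the pairing *)

Section Pairing.
Context (p : pairing).

Definition pl (n : nat) : nat := (pair_decode p n).1.
Definition pr (n : nat) : nat := (pair_decode p n).2.

Lemma plK x y : pl (p x y) = x. Proof. by rewrite /pl pair_codeK. Qed.
Lemma prK x y : pr (p x y) = y. Proof. by rewrite /pr pair_codeK. Qed.
Lemma plrK n : p (pl n) (pr n) = n. Proof. exact: pair_decodeK. Qed.

Lemma pl_le n : (pl n <= n)%N.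
Proof. by rewrite -{2}[n]plrK; case: (pair_ge p (pl n) (pr n)). Qed.

Lemma pr_le n : (pr n <= n)%N.
Proof. by rewrite -{2}[n]plrK; case: (pair_ge p (pl n) (pr n)). Qed.

Lemma rec_on_pair n F G : rec_on n F -> rec_on n G ->
  rec_on n (fun s => p (F s) (G s)).
Proof. exact: rec_on_computable2 (pair_computable p). Qed.

(** A [pairing] provides computability of the coding only, so the projection is found by search. The
    inner quantifier is bounded because the second component of a code is at most the code. *)
Lemma rec_on_pl n F : rec_on n F -> rec_on n (fun s => pl (F s)).
Proof.
apply: (rec_on_comp1 pl).
apply: (rec_on_min 1 (fun x s =>
  ~~ all (fun y => p x y != nth 0%N s 0) (iota 0 (nth 0%N s 0).+1))).
  apply/rec_on_neg/(rec_on_all 2 (fun y s => p (nth 0%N s 0) y != nth 0%N (drop 1 s) 0)).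
    apply/rec_on_neg/rec_on_eq; last exact: rec_on_drop_drop.
    by apply: rec_on_pair; [exact: rec_on_drop|exact: rec_on_var].
  by apply: rec_on_S; exact: rec_on_drop.
move=> v; split=> [|k lt_k]; last first.
  rewrite negbK; apply/allP => y _; apply: contraTneq lt_k => <-.
  by rewrite plK ltnn.
apply/negP => /allP/(_ (pr (nth 0%N v 0))); rewrite mem_iota ltnS pr_le plrK eqxx.
by move=> /(_ isT).
Qed.

Lemma rec_on_pr n F : rec_on n F -> rec_on n (fun s => pr (F s)).
Proof.
apply: (rec_on_comp1 pr).
apply: (rec_on_min 1 (fun y s => p (pl (nth 0%N s 0)) y == nth 0%N s 0)).
  apply: rec_on_eq; last exact: rec_on_drop.
  by apply: rec_on_pair; [apply/rec_on_pl/rec_on_drop|exact: rec_on_var].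
move=> v; split=> [|k lt_k]; first by rewrite plrK.
by apply: contraTneq lt_k => <-; rewrite prK ltnn.
Qed.

End Pairing.

(** * The enumeration [alpha] of the finite elements *)

Lemma rec_on_nth (c : seq_coding) n F G : rec_on n F -> rec_on n G ->
  rec_on n (fun s => nth 0%N (seq_decode c (F s)) (G s)).
Proof. exact: rec_on_computable2 (entry_computable c). Qed.

Lemma eq_ltn m n : (forall x, (x < m)%N = (x < n)%N) -> m = n.
Proof.
move=> mn; apply/eqP; rewrite eqn_leq !(leqNgt m) !(leqNgt n).
by rewrite mn ltnn -mn ltnn.
Qed.

Section AlphaIndex.
Context {p : pairing} {c : seq_coding} {A : set nat} {fA : nat -> nat}.
Hypotheses (A_inf : infinite_set A) (fA_comp : computable1 fA).
Hypothesis fA_range : range fA = A.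

Local Notation ah := (alpha_hat p c fA_range).
Local Notation hlen j := (fA (pr p j)).
Local Notation hval j x := (nth 0%N (seq_decode c (pl p j)) x).

(** The padding by 0 is absorbed by the default of [nth], which merges the first two cases of the
    definition. *)
Lemma alpha_hatE j x :
  shat_fun (ah j) x = if (x < hlen j)%N then Some (hval j x) else None.
Proof.
rewrite /alpha_hat /pl /pr; case: pair_decode => a b /=.
rewrite /alpha_hat_pfun /entry /lth leq_min /=.
have [lt_x|le_x] := ltnP x (size (seq_decode c a));
  by rewrite ?(nth_default _ le_x); case: (x < fA b)%N.
Qed.

Lemma eq_Shat (u v : Shat A) : (forall x, shat_fun u x = shat_fun v x) -> u = v.
Proof. by move=> uv; apply: val_inj; apply/funext. Qed.

Lemma alpha_hat_eq i j : (ah i == ah j) =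
  (hlen i == hlen j) && all (fun x => hval i x == hval j x) (iota 0 (hlen i)).
Proof.
apply/eqP/andP => [eq_ij|[/eqP eq_len /allP eq_val]].
  have eq_x x : shat_fun (ah i) x = shat_fun (ah j) x by rewrite eq_ij.
  have eq_len : hlen i = hlen j.
    apply: eq_ltn => x; have := eq_x x; rewrite !alpha_hatE.
    by do 2 case: ifP.
  rewrite eq_len; split=> //; apply/allP => x; rewrite mem_iota /= => lt_x.
  by have := eq_x x; rewrite !alpha_hatE eq_len lt_x => -[->].
apply: eq_Shat => x; rewrite !alpha_hatE -eq_len; case: ifP => // lt_x.
by rewrite (eqP (eq_val x _)) // mem_iota.
Qed.

Lemma alpha_hat_nowhere i : (ah i == nowhere A) = (hlen i == 0%N).
Proof.
apply/eqP/eqP => [ahi|len0]; last first.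
  by apply: eq_Shat => x; rewrite alpha_hatE len0.
apply/eqP; rewrite -leqn0 leqNgt; apply/negP => len_gt0.
have : shat_fun (ah i) 0%N = shat_fun (nowhere A) 0%N by rewrite ahi.
by rewrite alpha_hatE len_gt0.
Qed.

(** Every element of [A] is the domain length of some [ah j]; a finite list containing all of them
    would make [A] finite. *)
Lemma alpha_hat_fresh (s : seq (Shat A)) : exists j, ah j \notin s.
Proof.
have [//|no_fresh] := pselect (exists j, ah j \notin s).
(* The default 0 is returned only for total functions, which have no length. *)
pose len (u : Shat A) := xget 0%N [set a | forall x, shat_fun u x = (x < a)%N :> bool].
case: A_inf; apply: (@sub_finite_set _ _ [set` [seq len u | u <- s]]).
  move=> a Aa; have [b _ <-] : range fA a by rewrite fA_range.
  apply/mapP; exists (ah (p 0%N b)).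
    by have [//|ns] := boolP (ah (p 0%N b) \in s); case: no_fresh; exists (p 0%N b).
  rewrite /len; case: xgetP => [m _ mP|/(_ (fA b)) []].
    by apply: eq_ltn => x; rewrite -mP alpha_hatE prK; case: ifP.
  by move=> x; rewrite alpha_hatE prK; case: ifP.
exact: finite_seq.
Qed.

Definition listed (r : nat) : seq (Shat A) := nowhere A :: [seq ah j | j <- iota 0 r].

Definition next_fresh (r : nat) : nat := ex_minn (alpha_hat_fresh (listed r)).

Lemma rec_on_next_fresh n F : rec_on n F -> rec_on n (fun s => next_fresh (F s)).
Proof.
have hlenP m G : rec_on m G -> rec_on m (fun s => hlen (G s)).
  by move=> GP; apply: rec_on_computable1 fA_comp _; apply: rec_on_pr.
have hvalP m G H : rec_on m G -> rec_on m H -> rec_on m (fun s => hval (G s) (H s)).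
  by move=> GP HP; apply: rec_on_nth HP; apply: rec_on_pl.
pose eqv i j := (hlen i == hlen j) &&
  all (fun x => hval i x == hval j x) (iota 0 (hlen i)).
have eqvP : rec_on 2 (fun s => eqv (nth 0%N s 0) (nth 0%N s 1) : nat).
  apply: rec_on_and.
    by apply: rec_on_eq; apply: hlenP; apply: rec_on_var.
  apply: (rec_on_all 2 (fun x s => hval (nth 0%N s 0) x == hval (nth 0%N s 1) x)).
    by apply: rec_on_eq; apply: hvalP; first [exact: rec_on_drop|exact: rec_on_var].
  by apply: hlenP; exact: rec_on_var.
apply: (rec_on_comp1 next_fresh).
apply: (rec_on_min 1 (fun j s => ~~ (hlen j == 0%N) &&
  all (fun i => ~~ (ah j == ah i)) (iota 0 (nth 0%N s 0)))) => [|v].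
  apply: rec_on_and.
    apply/rec_on_neg/rec_on_eq; last exact: rec_on_const.
    by apply: hlenP; exact: rec_on_var.
  apply: (rec_on_all 2 (fun i s => ~~ (ah (nth 0%N s 0) == ah i))
     (fun s => nth 0%N (drop 1 s) 0)); last exact: rec_on_drop.
  apply/rec_on_neg.
  have -> : (fun s => ah (nth 0%N (drop 2 s) 0) == ah (nth 0%N s 0) : nat) =
      (fun s => eqv (nth 0%N (drop 2 s) 0) (nth 0%N s 0) : nat).
    by apply/funext => s; rewrite alpha_hat_eq.
  by apply: (rec_on_comp2 eqv eqvP); [exact: rec_on_drop|exact: rec_on_var].
have freshE j : (~~ (hlen j == 0%N) &&
    all (fun i => ~~ (ah j == ah i)) (iota 0 (nth 0%N v 0))) =
    (ah j \notin listed (nth 0%N v 0)).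
  rewrite inE negb_or alpha_hat_nowhere; congr (_ && _).
  apply/allP/negP => [nj /mapP[i ri ji]|nj i ri].
    by have := nj i ri; rewrite ji eqxx.
  by apply/eqP => ji; apply: nj; apply/mapP; exists i.
rewrite /next_fresh; case: ex_minnP => j fresh_j min_j.
rewrite freshE; split=> // k lt_kj.
by rewrite freshE; apply: contraL lt_kj; rewrite -leqNgt; exact: min_j.
Qed.

(** The indices chosen by [next_alpha] increase, so after [i] steps the functions
    already listed are exactly the [alpha_hat j] with [j < listed_upto i]. *)
Definition listed_upto (i : nat) : nat := prec 0%N (fun _ r => (next_fresh r).+1) i.

(** [next_alpha] depends on a list only through its members, so agreement up to [=i] suffices and
    repetitions in [listed] are harmless. *)
Lemma mem_alpha_upto i :
  alpha_upto p c fA_range i =i listed (listed_upto i) /\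
  alpha p c fA_range i.+1 = ah (next_fresh (listed_upto i)).
Proof.
have nextE s r : s =i listed r -> next_alpha p c fA_range s = ah (next_fresh r).
  move=> sE; rewrite /next_alpha; case: pselect => [ex|[]]; last first.
    by have [j fj] := alpha_hat_fresh (listed r); exists j; rewrite sE.
  congr (ah _); rewrite /next_fresh.
  case: ex_minnP => j fj jmin; case: ex_minnP => k fk kmin.
  apply/eqP; rewrite eqn_leq jmin ?kmin ?sE //.
  by rewrite -sE.
suff sE : alpha_upto p c fA_range i =i listed (listed_upto i).
  by split=> //; rewrite /alpha /= last_rcons (nextE _ _ sE).
elim: i => [u|i IH u] //=.
rewrite mem_rcons inE (nextE _ _ IH) IH.
change (listed_upto i.+1) with (next_fresh (listed_upto i)).+1.
move: (listed_upto i) => r; rewrite /next_fresh.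
case: ex_minnP => j fj jmin.
(* A fresh index is at least [r]. By minimality of [j], the indices from [r] up to but excluding [j]
   yield listed functions, so passing to [j.+1] adds [ah j] alone. *)
have le_rj : (r <= j)%N.
  rewrite leqNgt; apply: contra fj => lt_jr.
  by rewrite inE; apply/orP; right; apply/mapP; exists j => //; rewrite mem_iota.
have listedS m k : (k < m)%N -> ah k \in listed m.
  by move=> lt_km; rewrite inE map_f ?orbT // mem_iota.
have listedP m w : w \in listed m -> w = nowhere A \/ exists2 k, (k < m)%N & w = ah k.
  rewrite inE => /orP[/eqP ->|/mapP[k]]; first by left.
  by rewrite mem_iota => lt_km ->; right; exists k.
apply/orP/idP => [[/eqP ->|/listedP[->|[k lt_kr ->]]]|/listedP[->|[k lt_kj ->]]].
- exact: listedS.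
- exact: mem_head.
- by apply: listedS; rewrite ltnS (leq_trans (ltnW lt_kr)).
- by right; exact: mem_head.
have [->|ne_kj] := eqVneq k j; first by left.
right; apply: contraTT lt_kj => /jmin le_jk.
by rewrite -leqNgt ltn_neqAle eq_sym ne_kj.
Qed.

Lemma rec_on_listed_upto n F : rec_on n F -> rec_on n (fun s => listed_upto (F s)).
Proof.
move=> FP; apply: (rec_on_prec n (fun=> 0%N) (fun _ r _ => (next_fresh r).+1)) => //.
  exact: rec_on_const.
by apply/rec_on_S/rec_on_next_fresh/rec_on_var.
Qed.

Definition alpha_index (i : nat) : nat := next_fresh (listed_upto i).

Lemma alphaS i : alpha p c fA_range i.+1 = ah (alpha_index i).
Proof. by have [_] := mem_alpha_upto i. Qed.

Lemma rec_on_alpha_index n F : rec_on n F -> rec_on n (fun s => alpha_index (F s)).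
Proof. by move=> FP; apply/rec_on_next_fresh/rec_on_listed_upto. Qed.

End AlphaIndex.

(** * Approximating the supremum by stages *)

Section WayBelow.
Context {d : Order.disp_t} {D : porderType d}.
Implicit Types (x y z : D) (B L : set D).

Lemma directed1 x : directed [set x].
Proof. by split=> [|y z -> ->]; exists x. Qed.

Lemma way_below_le {x y} : way_below x y -> x <= y.
Proof.
by move=> /(_ [set y] y (directed1 y)); rewrite supremums1 => /(_ erefl (lexx y))[_ ->].
Qed.

Lemma way_below_le_trans {x} y {z} : way_below x y -> y <= z -> way_below x z.
Proof. by move=> xy yz L s dL sL zs; apply: xy dL sL (le_trans yz zs). Qed.

Lemma le_way_below_trans {x} y {z} : x <= y -> way_below y z -> way_below x z.
Proof.
move=> xy yz L s dL sL zs; have [u Lu yu] := yz L s dL sL zs.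
by exists u => //; exact: le_trans yu.
Qed.

Lemma way_below_bot {x} y : (forall z, x <= z) -> way_below x y.
Proof. by move=> x_bot L s [[u Lu] _] _ _; exists u. Qed.

Lemma directed_sup2 {L s x y} : directed L -> supremums L s ->
  way_below x s -> way_below y s -> exists2 u, L u & x <= u /\ y <= u.
Proof.
move=> dL sL xs ys; have [u Lu xu] := xs L s dL sL (lexx s).
have [v Lv yv] := ys L s dL sL (lexx s).
have [w Lw [uw vw]] := dL.2 u v Lu Lv.
by exists w; last by split; [exact: le_trans uw|exact: le_trans vw].
Qed.

(** Approximating twice, the base elements way below base elements way below [z] contain a directed
    family with supremum [z]. One member [u] is above [x] and [y], and the [v] with [u] way below
    [v] way below [z] interpolates. *)
Lemma way_below_interpolation {B x y z} : is_basis B ->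
  way_below x z -> way_below y z ->
  exists2 b, B b & [/\ way_below x b, way_below y b & way_below b z].
Proof.
move=> /choice[M MP] xz yz.
have [Mz_below dMz sMz] := MP z.
pose L : set D := \bigcup_(v in M z) M v.
have dL : directed L.
  split=> [|u1 u2 [v1 Mv1 Mu1] [v2 Mv2 Mu2]].
    have [v Mv] := dMz.1; have [_ dMv _] := MP v.
    by have [u Mu] := dMv.1; exists u, v.
  have [v Mv [v1v v2v]] := dMz.2 _ _ Mv1 Mv2.
  have [_ dMv sMv] := MP v.
  have below_v w u : M w u -> w <= v -> way_below u v.
    by move=> Mwu; apply: way_below_le_trans; have [/(_ _ Mwu)[]] := MP w.
  have [w Mw uw] := directed_sup2 dMv sMv (below_v _ _ Mu1 v1v) (below_v _ _ Mu2 v2v).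
  by exists w => //; exists v.
have sL : supremums L z.
  split=> [u [v Mv Mu]|w wub].
    have [/(_ _ Mu)[_ /way_below_le uv] _ _] := MP v.
    exact: le_trans (sMz.1 v Mv).
  apply: sMz.2 => v Mv; have [_ _ sMv] := MP v; apply: sMv.2 => u Mu.
  by apply: wub; exists v.
have [u [v Mv Mu] [xu yu]] := directed_sup2 dL sL xz yz.
have [Bv vz] := Mz_below v Mv.
have [/(_ _ Mu)[_ uv] _ _] := MP v.
by exists v => //; split=> //; exact: le_way_below_trans uv.
Qed.

End WayBelow.

(** * The chain of base elements read off from a function *)

Section Stages.
Context (p : pairing) (h : nat -> nat) (k0 : nat).
Implicit Types (f g : nat -> nat) (m n t : nat).

(** The state [st = <k, t>] records the current member [beta k] and the number [t]
    of extensions made.  The stage number [n = <<u1, u2>, <<u3, m>, _>>] guesses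
    that [h u1 = <k, k'>], [h u2 = <k', f m>] and, if [t = <a, m'>] with
    [h a = <e, f m'>], that [h u3 = <e, k'>]; the last component makes every
    guess recur. *)
Definition step_ok f n st : bool :=
  let k' := pr p (h (pl p (pl p n))) in
  let t := pr p st in
  [&& pl p (h (pl p (pl p n))) == pl p st,
      h (pr p (pl p n)) == p k' (f (pr p (pl p (pr p n)))) &
      (pr p (h (pl p t)) == f (pr p t)) ==>
      (h (pl p (pl p (pr p n))) == p (pl p (h (pl p t))) k')].

Definition step f n st : nat :=
  if step_ok f n st then p (pr p (h (pl p (pl p n)))) (pr p st).+1 else st.

Definition stage f n : nat := prec (p k0 0%N) (step f) n.

(** The function read is given by an index, uniformly; thus the value of Gamma at a finite function
    can be computed from its code. *)
Lemma rec_on_stage (e : nat -> nat -> nat) {n F G} :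
  computable1 h -> computable2 e -> rec_on n F -> rec_on n G ->
  rec_on n (fun s => stage (e (F s)) (G s)).
Proof.
move=> h_comp e_comp FP GP.
have RE m H : rec_on m H -> rec_on m (fun s => h (H s)).
  exact: rec_on_computable1.
have stepP m F' G' H' : rec_on m F' -> rec_on m G' -> rec_on m H' ->
    rec_on m (fun s => step (e (F' s)) (G' s) (H' s)).
  move=> F'P G'P H'P; apply: rec_on_if => //; last first.
    by repeat first [assumption|apply: rec_on_pair|apply: rec_on_S
      |apply: rec_on_pr|apply: rec_on_pl|apply: RE].
  by repeat first [assumption|apply: rec_on_and|apply: rec_on_imply
      |apply: rec_on_eq|apply: rec_on_pair|apply: rec_on_S
      |apply: rec_on_pr|apply: rec_on_pl|apply: RE|apply: rec_on_computable2].
apply: (rec_on_comp2 (fun a x => stage (e a) x)) FP GP.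
apply: (rec_on_prec 2 (fun=> p k0 0%N) (fun k r s => step (e (nth 0%N s 0)) k r)).
- exact: rec_on_const.
- by apply: stepP; first [exact: rec_on_drop|exact: rec_on_var].
- exact: rec_on_var.
Qed.

Lemma stage0 f : stage f 0 = p k0 0%N. Proof. by []. Qed.

Lemma stageS f n : stage f n.+1 = step f n (stage f n). Proof. by []. Qed.

(** Keeps the request treated at stage [n] about arguments at most [n]. *)
Lemma stage_count f n : (pr p (stage f n) <= n)%N.
Proof.
elim: n => [|n IH]; first by rewrite stage0 prK.
by rewrite stageS /step; case: ifP => _; rewrite ?prK ?ltnS // leqW.
Qed.

Lemma eq_stage f g n : (forall x, (x < n)%N -> f x = g x) -> stage f n = stage g n.
Proof.
elim: n => [//|n IH] fg; rewrite !stageS -IH => [|x xn]; last exact/fg/leqW.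
have fgm : f (pr p (pl p (pr p n))) = g (pr p (pl p (pr p n))).
  apply: fg; rewrite ltnS.
  exact: leq_trans (pr_le _ _) (leq_trans (pl_le _ _) (pr_le _ _)).
have fgt : f (pr p (pr p (stage f n))) = g (pr p (pr p (stage f n))).
  by apply: fg; rewrite ltnS (leq_trans (pr_le _ _)) // stage_count.
by rewrite /step /step_ok fgm fgt.
Qed.

Context {d : Order.disp_t} {D : porderType d} {B : set D} {beta : nat -> D}.
Hypothesis B_basis : is_basis B.
Hypothesis beta_B : range beta = B.
Hypothesis k0_bot : forall x, beta k0 <= x.
Hypothesis hP : forall i j, way_below (beta i) (beta j) <-> exists u, h u = p i j.

Lemma h_way_below u : way_below (beta (pl p (h u))) (beta (pr p (h u))).
Proof. by apply/hP; exists u; rewrite plrK. Qed.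

Lemma stage_okP f n : step_ok f n (stage f n) ->
  [/\ way_below (beta (pl p (stage f n))) (beta (pl p (stage f n.+1))),
      exists2 m, (m <= n)%N & way_below (beta (pl p (stage f n.+1))) (beta (f m)),
      pr p (stage f n.+1) = (pr p (stage f n)).+1 &
      let t := pr p (stage f n) in pr p (h (pl p t)) = f (pr p t) ->
      way_below (beta (pl p (h (pl p t)))) (beta (pl p (stage f n.+1)))].
Proof.
move=> ok; rewrite stageS /step ok plK prK; move: ok => /and3P[/eqP <- /eqP h2 h3].
split=> //.
- exact: h_way_below.
- exists (pr p (pl p (pr p n))); last by apply/hP; eexists; exact: h2.
  exact: leq_trans (pr_le _ _) (leq_trans (pl_le _ _) (pr_le _ _)).
- move=> /= req; apply/hP; eexists; apply/eqP.
  by move: h3; rewrite req eqxx => /implyP; apply.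
Qed.

Lemma stage_leS f n : beta (pl p (stage f n)) <= beta (pl p (stage f n.+1)).
Proof.
have [ok|nok] := boolP (step_ok f n (stage f n)).
  by have [/way_below_le] := stage_okP _ _ ok.
by rewrite stageS /step (negbTE nok).
Qed.

Lemma stage_le f m n : (m <= n)%N ->
  beta (pl p (stage f m)) <= beta (pl p (stage f n)).
Proof.
move=> /subnK <-; elim: (n - m)%N => [//|i IH].
by rewrite addSn (le_trans IH (stage_leS _ _)).
Qed.

Lemma stage_below f n : pl p (stage f n) = k0 \/
  exists2 m, (m < n)%N & way_below (beta (pl p (stage f n))) (beta (f m)).
Proof.
elim: n => [|n IH]; first by left; rewrite stage0 plK.
have [ok|nok] := boolP (step_ok f n (stage f n)).
  by have [_ [m mn km] _ _] := stage_okP _ _ ok; right; exists m.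
rewrite stageS /step (negbTE nok); case: IH => [|[m mn km]]; [by left|right].
by exists m => //; rewrite leqW.
Qed.

(** Directedness puts one value [beta (f m)] above those bounding the current member and the
    requested element; interpolation below it gives the new member. *)
Lemma step_ok_exists f n k t : directed (beta @` range f) ->
  (exists m, way_below (beta k) (beta (f m))) ->
  exists2 n', (n <= n')%N & step_ok f n' (p k t).
Proof.
move=> [_ f_dir] [m0 km0].
have fD i : (beta @` range f) (beta (f i)) by exists (f i) => //; exists i.
pose req := pr p (h (pl p t)) == f (pr p t).
(* A void request is replaced by the current member, so that both cases are treated alike. *)
pose e := if req then pl p (h (pl p t)) else k.
have [m1 em1] : exists m1, way_below (beta e) (beta (f m1)).
  rewrite /e; case: ifP => [/eqP req_t|_]; last by exists m0.
  by exists (pr p t); rewrite -req_t; exact: h_way_below.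
have [_ [_ [m _ <-] <-] [m0m m1m]] := f_dir _ _ (fD m0) (fD m1).
have [b Bb [kb eb bm]] := way_below_interpolation B_basis
  (way_below_le_trans _ km0 m0m) (way_below_le_trans _ em1 m1m).
move: Bb; rewrite -beta_B => -[k' _ k'b]; rewrite -{}k'b in kb eb bm.
have [u1 h1] := (hP k k').1 kb; have [u2 h2] := (hP k' (f m)).1 bm.
have [u3 h3] := (hP e k').1 eb.
(* The idle component [n] makes the guess at least [n], as a code dominates its components. *)
exists (p (p u1 u2) (p (p u3 m) n)).
  by apply: leq_trans (pair_ge p _ _).2; exact: (pair_ge p _ _).2.
rewrite /step_ok !(plK, prK) h1 h2 h3 !(plK, prK) !eqxx /=.
by apply/implyP => treq; rewrite /e /req treq.
Qed.

Lemma stage_progress f n : directed (beta @` range f) ->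
  exists n', step_ok f n' (stage f n') /\ pr p (stage f n') = pr p (stage f n).
Proof.
move=> f_dir.
have [|n' le_nn'] := step_ok_exists f n (pl p (stage f n)) (pr p (stage f n)) f_dir.
  have [->|[m _ km]] := stage_below f n; last by exists m.
  by exists 0%N; exact: way_below_bot.
rewrite plrK => ok_n'.
have [//|stuck] := pselect (exists n', step_ok f n' (stage f n') /\
  pr p (stage f n') = pr p (stage f n)).
(* If no step succeeds with this count, the state is frozen from stage [n] on; the guess [n'] then
   meets the very state for which it is correct. *)
suff stageE i : stage f (i + n) = stage f n.
  by exists n'; rewrite -(subnK le_nn') stageE subnK.
elim: i => [//|i IH]; rewrite addSn stageS /step IH.
have [ok|//] := boolP (step_ok f (i + n) (stage f n)).
by case: stuck; exists (i + n)%N; rewrite IH.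
Qed.

Lemma stage_request f t : directed (beta @` range f) ->
  exists n, step_ok f n (stage f n) /\ pr p (stage f n) = t.
Proof.
move=> f_dir; elim: t => [|t [n [ok cnt]]].
  by have [n] := stage_progress f 0 f_dir; rewrite stage0 prK; exists n.
have [n' [ok' cnt']] := stage_progress f n.+1 f_dir; exists n'; split=> //.
by rewrite cnt'; have [_ _ -> _] := stage_okP _ _ ok; rewrite cnt.
Qed.

(** Each [beta (f m)] is the supremum of base elements way below it. Any such element is [beta i]
    with [h a = p i (f m)], and the extension serving the request [p a m] lies above it. *)
Lemma stage_ub f y : directed (beta @` range f) ->
  (forall n, beta (pl p (stage f n)) <= y) -> ubound (beta @` range f) y.
Proof.
move=> f_dir yub _ [_ [m _ <-] <-].
have [L [LB _ sL]] := B_basis (beta (f m)); apply: sL.2 => u /LB[].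
rewrite -beta_B => -[i _ <-] /hP[a ha].
have [n [ok cnt]] := stage_request f (p a m) f_dir.
have [_ _ _] := stage_okP _ _ ok; rewrite /= cnt !(plK, prK) ha !(plK, prK).
by move=> /(_ erefl)/way_below_le iu; exact: le_trans iu (yub n.+1).
Qed.

End Stages.

(** * The map Gamma *)

Section ShatOrder.
Context {A : set nat}.
Implicit Types u v w : Shat A.

Definition defined_below u n : Prop := forall x, (x < n)%N -> shat_fun u x.

Definition total_ext u (x : nat) : nat := odflt 0%N (shat_fun u x).

Lemma ShatP u : (forall n, defined_below u n) \/
  exists a, forall x, shat_fun u x = (x < a)%N :> bool.
Proof.
have := shat_mem u; rewrite inE => -[tot|[none|[a _ fa]]].
- by left=> n x _; exact: tot.
- by right; exists 0%N => x; rewrite none.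
- by right; exists a.
Qed.

Lemma defined_belowS u x : shat_fun u x -> defined_below u x.+1.
Proof.
case: (ShatP u) => [tot _|[a ua]]; first exact: tot.
by rewrite ua => xa y yx; rewrite ua (leq_trans yx).
Qed.

Lemma defined_below_leq u m n : (m <= n)%N -> defined_below u n -> defined_below u m.
Proof. by move=> mn un x xm; apply: un; exact: leq_trans mn. Qed.

Lemma Shat_leP u v :
  u <= v <-> forall x y, shat_fun u x = Some y -> shat_fun v x = Some y.
Proof. by split=> [/asboolP|uv]; last exact/asboolP. Qed.

Lemma total_ext_le u v n x : u <= v -> defined_below u n -> (x < n)%N ->
  total_ext u x = total_ext v x.
Proof.
move=> /Shat_leP uv un xn; rewrite /total_ext.
by have := un x xn; case ux: (shat_fun u x) => [y|//] _; rewrite (uv _ _ ux).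
Qed.

Lemma defined_below_le u v n : u <= v -> defined_below u n -> defined_below v n.
Proof.
move=> /Shat_leP uv un x xn.
by have := un x xn; case ux: (shat_fun u x) => [y|//] _; rewrite (uv _ _ ux).
Qed.

(** Otherwise a member of [L] with the longest initial segment of definedness would bound [L], hence
    lie above [w], although [w] is defined further. *)
Lemma supremums_defined (L : set (Shat A)) w n : directed L -> supremums L w ->
  defined_below w n -> exists2 u, L u & defined_below u n.
Proof.
move=> [[u0 Lu0] dirL] [w_ub w_least]; case: n => [|n] wn.
  by exists u0.
have [//|none] := pselect (exists2 u, L u & defined_below u n.+1).
pose P m := `[< exists2 u, L u & defined_below u m >].
have exP : exists m, P m by exists 0%N; apply/asboolP; exists u0.
have ltP m : P m -> (m <= n)%N.
  move=> /asboolP[u Lu um]; rewrite leqNgt; apply/negP => nm; apply: none.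
  by exists u => //; exact: defined_below_leq nm um.
case: (ex_maxnP exP ltP) => m /asboolP[u Lu um] m_max.
have no_m v : L v -> shat_fun v m = None.
  move=> Lv; case vm: (shat_fun v m) => [y|//].
  suff /m_max : P m.+1 by rewrite ltnn.
  by apply/asboolP; exists v => //; apply: defined_belowS; rewrite vm.
(* No member is defined at [m], so a common upper bound [z] of [u] and [v] lives below [m], where
   [u] is defined and agrees with it. *)
have /w_least/Shat_leP w_u : ubound L u.
  move=> v Lv; have [z Lz [uz vz]] := dirL u v Lu Lv.
  apply/Shat_leP => x y vx.
  have zx := (Shat_leP v z).1 vz _ _ vx.
  have [xm|mx] := ltnP x m; last first.
    have /defined_belowS/(_ m) : shat_fun z x by rewrite zx.
    by rewrite ltnS mx no_m // => /(_ isT).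
  have := um x xm; case ux: (shat_fun u x) => [y'|//] _.
  by have := (Shat_leP u z).1 uz _ _ ux; rewrite zx => ->.
case: none; exists u => // x xn; have := wn x xn.
by case wx: (shat_fun w x) => [y|//] _; rewrite (w_u _ _ wx).
Qed.

End ShatOrder.

Theorem theorem9p9 (p : pairing) (c : seq_coding)
    (A : set nat) (A_ce : ce A) (A_inf : infinite_set A)
    (fA : nat -> nat) (fA_comp : computable1 fA) (fA_range : range fA = A)
    (d : Order.disp_t) (D : porderType d) (B : set D) (beta : nat -> D)
    (D_eff : effectively_given p B beta) :
  exists Gamma : Shat A -> D,
    [/\ computable_map p (alpha p c fA_range) beta Gamma,
        forall y : D, exists f : Shat A, Gamma f = y
      & forall f : Shat A,
        [/\ anf A f -> B (Gamma f),
            directed (beta @` prange f) ->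
              exists2 s, supremums (beta @` prange f) s & Gamma f <= s
          & total_computable f ->
            directed (beta @` prange f) ->
              supremums (beta @` prange f) (Gamma f)]].
Proof.
have [[bot bot_le] D_sup B_basis beta_B ce_W] := D_eff.
(* A base element approximating the bottom is the bottom. *)
have [k0 k0_bot] : exists k0, forall x, beta k0 <= x.
  have [L [LB [[u Lu] _] sL]] := B_basis bot.
  have [] := LB u Lu; rewrite -beta_B => -[k0 _ k0u] _; exists k0 => x.
  by rewrite k0u (le_trans (sL.1 u Lu)).
have [h h_comp hP] : exists2 h, computable1 h &
    forall i j, way_below (beta i) (beta j) <-> exists u, h u = p i j.
  case: ce_W => [W0|[h h_comp hW]].
    suff : (set0 : set nat) (p k0 k0) by [].
    by rewrite -W0; exists k0, k0; split=> //; exact: way_below_bot.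
  exists h => // i j; split=> [ij|[u hu]].
    have [u _ hu] : range h (p i j) by rewrite hW; exists i, j.
    by exists u.
  have : range h (p i j) by exists u.
  rewrite hW => -[i' [j' [/(congr1 (fun n => (pl p n, pr p n)))]]].
  by rewrite !(plK, prK) => -[-> ->].
pose key (f : Shat A) n := pl p (stage p h k0 (total_ext f) n).
(* Only stages reading defined values are kept, so the default 0 of [total_ext] never matters. *)
pose chain (f : Shat A) : set D := [set beta (key f n) | n in defined_below f].
have chain_dir f : directed (chain f).
  split=> [|_ _ [m fm <-] [n fn <-]]; first by exists (beta (key f 0%N)), 0%N.
  exists (beta (key f (maxn m n))); last first.
    by split; apply: (stage_le _ _ _ hP); rewrite (leq_maxl, leq_maxr).
  by exists (maxn m n) => //; case: leqP.
have /choice[G GP] : forall f, exists s, supremums (chain f) s.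
  by move=> f; exact: D_sup.
have key_le f g n : f <= g -> defined_below f n -> key f n = key g n.
  move=> fg fn; rewrite /key; congr (pl p _); apply: eq_stage => x xn.
  exact: total_ext_le xn.
(* For a domain of length [a] the chain ends with stage [a]. *)
have G_fin f a : (forall x, shat_fun f x = (x < a)%N :> bool) -> G f = beta (key f a).
  move=> fa; apply: (is_subset1_supremums (GP f)); split=> [_ [n fn <-]|y]; last first.
    by apply; exists a => // x xa; rewrite fa.
  apply: (stage_le _ _ _ hP); rewrite leqNgt; apply/negP => /fn.
  by rewrite fa ltnn.
have key_range f n : defined_below f n ->
    key f n = k0 \/ exists2 i, prange f i & way_below (beta (key f n)) (beta i).
  move=> fn; have [|[m mn km]] := stage_below p h k0 hP (total_ext f) n; first by left.
  right; exists (total_ext f m) => //; exists m; rewrite /total_ext.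
  by have := fn m mn; case: (shat_fun f m).
have G_le (f : Shat A) s : supremums (beta @` prange f) s -> G f <= s.
  move=> [s_ub _]; apply: (GP f).2 => _ [n fn <-].
  have [->//|[i fi /way_below_le ki]] := key_range f n fn.
  by apply: le_trans ki _; apply: s_ub; exists i.
have G_total (f : Shat A) : total_funs f -> directed (beta @` prange f) ->
    supremums (beta @` prange f) (G f).
  move=> f_tot f_dir; have [s sP] := D_sup _ f_dir.
  have prangeE : prange f = range (total_ext f).
    rewrite /total_ext; apply/seteqP; split=> y [x].
      by move=> fx; exists x => //; rewrite fx.
    by move=> _ <-; exists x; have := f_tot x; case: (shat_fun f x).
  split=> [|y y_ub]; last by apply: le_trans (G_le f s sP) (sP.2 y y_ub).
  rewrite prangeE in f_dir *; apply: (stage_ub _ _ _ B_basis beta_B k0_bot hP _ _ f_dir).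
  by move=> n; apply: (GP f).1; exists n => // x _; exact: f_tot.
have G_mono f g : f <= g -> G f <= G g.
  move=> fg; apply: (GP f).2 => _ [n fn <-].
  rewrite (key_le f g n fg fn); apply: (GP g).1; exists n => //.
  exact: defined_below_le fn.
pose idx := @alpha_index p c A fA A_inf fA_range.
(* A computable base index for the value at [alpha i]. Entries beyond the length
   [fA (pr p (idx i.-1))] are not consulted, and index 0 is the nowhere defined function. *)
pose kappa i := if i == 0%N then k0 else
  pl p (stage p h k0 (nth 0%N (seq_decode c (pl p (idx i.-1)))) (fA (pr p (idx i.-1)))).
have G_alpha i : G (alpha p c fA_range i) = beta (kappa i).
  case: i => [|i]; first by rewrite (G_fin _ 0%N) // /key stage0 plK.
  rewrite alphaS (G_fin _ (fA (pr p (idx i)))); last first.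
    by move=> x; rewrite alpha_hatE; case: ifP.
  congr (beta (pl p _)); apply: eq_stage => x xn.
  by rewrite /total_ext alpha_hatE xn.
exists G; split; last first.
- move=> f; split.
  + move=> [f0|[a _ fa]].
      rewrite (G_fin f 0%N) -?beta_B; first by eexists.
      by move=> x; rewrite f0.
    by rewrite (G_fin f a fa) -beta_B; eexists.
  + by move=> f_dir; have [s sP] := D_sup _ f_dir; exists s => //; exact: G_le.
  + by move=> [g _ fg]; apply: G_total => x; rewrite fg.
- move=> y; have [L [LB L_dir sL]] := B_basis y.
  have [u0 Lu0] := L_dir.1.
  have beta_L u : L u -> exists i, beta i = u.
    by move=> /LB[]; rewrite -beta_B => -[i _ <-]; exists i.
  have [i0 i0u] := beta_L _ Lu0.
  (* A total function, in general not computable, whose range names exactly the members of [L]. *)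
  pose e x := if `[< L (beta x) >] then x else i0.
  have f_mem : (fun x => Some (e x)) \in (total_funs `|` anf A)%classic.
    by rewrite inE; left.
  pose f := MkShat f_mem.
  have fL : beta @` prange f = L.
    apply/seteqP; split=> [_ [_ [x [<-]] <-]|u Lu].
      by rewrite /e; case: asboolP => // _; rewrite i0u.
    have [i iu] := beta_L _ Lu; exists i => //; exists i.
    by rewrite /f /= /e iu asboolT.
  exists f; apply: (is_subset1_supremums _ sL).
  by rewrite -fL; apply: G_total => //; rewrite fL.
- split; first split.
  + exact: G_mono.
  + move=> L s L_dir sL; split=> [_ [f Lf <-]|y y_ub].
      exact/G_mono/sL.1.
    (* A chain member of [s] at stage [n] uses finitely many values, which some [f] in [L] already
       has. *)
    apply: (GP s).2 => _ [n sn <-].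
    have [f Lf fn] := supremums_defined L s n L_dir sL sn.
    rewrite -(key_le f s n) //; last exact: sL.1.
    by apply: le_trans (y_ub (G f) _); [apply: (GP f).1; exists n|exists f].
(* Read [n] as an index [i] of [alpha] and a place [u] in the enumeration [h]: output [p i j] if
   [h u = p j (kappa i)], and otherwise [p 0 k0], which always qualifies since [beta k0] is the
   bottom. *)
- right; exists (fun n => if pr p (h (pr p n)) == kappa (pl p n)
    then p (pl p n) (pl p (h (pr p n))) else p 0%N k0).
    apply: computable1_rec_on.
    have ? := rec_on_var 1 0.
    have RE m H : rec_on m H -> rec_on m (fun s => h (H s)).
      exact: rec_on_computable1.
    have kappaP F : rec_on 1 F -> rec_on 1 (fun s => kappa (F s)).
      move=> FP; apply: rec_on_if; first exact: rec_on_eq (rec_on_const _ _).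
        exact: rec_on_const.
      apply/rec_on_pl/(rec_on_stage p h k0 (fun a x => nth 0%N (seq_decode c a) x)) => //.
      * exact: entry_computable.
        by apply/rec_on_pl/rec_on_alpha_index/rec_on_pred.
      apply: (rec_on_computable1 _ fA) => //.
      by apply/rec_on_pr/rec_on_alpha_index/rec_on_pred.
    apply: rec_on_if.
      by apply: rec_on_eq; repeat first [assumption|apply: rec_on_pr
        |apply: rec_on_pl|apply: RE|apply: kappaP].
      by repeat first [assumption|apply: rec_on_pair
        |apply: rec_on_pr|apply: rec_on_pl|apply: RE].
    exact: rec_on_const.
  apply/seteqP; split=> [n [m _ <-]|n [i [j [->]]]].
    case: eqP => [m_k|_]; last first.
      by exists 0%N, k0; split=> //; exact: way_below_bot.
    exists (pl p m), (pl p (h (pr p m))); split=> //.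
    by rewrite G_alpha -m_k; exact: (h_way_below _ _ hP).
  rewrite G_alpha => /hP[u hu]; exists (p i u) => //=.
  by rewrite !(plK, prK) hu !(plK, prK) eqxx.
Qed.
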